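(* Let $w\in FW^*$ be a non-degenerate Farey word, let $m_0:=|w|_0$ and $m_1:=|w|_1$, and let $J_w$ be the corresponding qumterval. Then there exist two elements $\mathbf{M},\mathbf{M}'\in PSL(2,\mathbb{Z})$ such that, for all $\alpha\in J_w$, $$\mathbf{M}_{\alpha,\alpha-1,m_0}=\mathbf{M},\qquad \mathbf{M}_{\alpha,\alpha,m_1}=\mathbf{M}'.$$ Moreover, the following matching condition holds in $PSL(2,\mathbb{Z})$: $$\mathbf{T}\mathbf{M}=\mathbf{M}'\mathbf{S}\mathbf{T}^{-1}\mathbf{S}.$$
   Context: Farey words. Let $F_0=(0,1)$ be the list of the two one-letter binary words; the list $F_{n+1}$ is obtained from $F_n$ by inserting between every two consecutive words $v,w$ of $F_n$ the concatenation $vw$. Put $FW=\bigcup_{n\ge0}F_n$ and $FW^*=FW\setminus\{0,1\}$. $|w|_0$ and $|w|_1$ are the numbers of digits $0$ and $1$ in $w$. Qumtervals. For a binary word $w$, $RL(w)$ is the string of positive integers recording the lengths of its successive maximal blocks of equal digits. For $w\in FW^*$ with $S=RL(w)$, the qumterval of label $w$ is $J_w=(\alpha^-,\alpha^+)$ where $\alpha^+=[0;\overline{S}]$ and $\alpha^-=1-[0;\overline{{}^tS}]$; here ${}^tS$ is the string $S$ reversed and $[0;\overline{S}]$ is the number whose regular continued fraction has partial quotients given by infinite repetition of $S$. Maps and matrices. For $\alpha\in(0,1)$ let $K_\alpha:[\alpha-1,\alpha]\to[\alpha-1,\alpha]$ be defined by $K_\alpha(0)=0$ and $K_\alpha(x)=-\frac1x-c_\alpha(x)$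 for $x\ne0$, with $c_\alpha(x)=\lfloor-\frac1x+1-\alpha\rfloor$. Put $c_{j,\alpha}(x)=c_\alpha(K_\alpha^{j-1}(x))$ for $j\ge1$ and $$\mathbf{M}_{\alpha,x,\ell}=\begin{pmatrix}0&-1\\1&c_{1,\alpha}(x)\end{pmatrix}\cdots\begin{pmatrix}0&-1\\1&c_{\ell,\alpha}(x)\end{pmatrix},$$ viewed in $PSL(2,\mathbb{Z})$. Finally $\mathbf{S}=\begin{pmatrix}0&-1\\1&0\end{pmatrix}$ and $\mathbf{T}=\begin{pmatrix}1&1\\0&1\end{pmatrix}$. *)

(* Defs.v *)
From HB Require Import structures.
From mathcomp Require Import all_boot all_order all_algebra generic_quotient.
From mathcomp Require Import all_classical all_reals all_analysis.
Import Order.TTheory GRing.Theory Num.Theory.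
Import numFieldNormedType.Exports.

Set Implicit Arguments.
Unset Strict Implicit.
Unset Printing Implicit Defensive.

Local Open Scope ring_scope.
Local Open Scope quotient_scope.

(* The digits 0 and 1 are [false] and [true]. *)
Definition word := seq bool.

Fixpoint farey_insert (l : seq word) : seq word :=
  match l with
  | v :: ((w :: _) as l') => v :: (v ++ w) :: farey_insert l'
  | _ => l
  end.

Definition farey_list (n : nat) : seq word :=
  iter n farey_insert [:: [:: false]; [:: true]].

Definition FW (w : word) : Prop := exists n, w \in farey_list n.

Definition FWstar (w : word) : Prop :=
  [/\ FW w, w <> [:: false] & w <> [:: true]].

Definition num0 (w : word) : nat := count_mem false w.
Definition num1 (w : word) : nat := count_mem true w.

(* When [RL w'] is nonempty, so is [w'], and [head a w'] is its first digit. *)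
Fixpoint RL (w : word) : seq nat :=
  if w is a :: w' then
    if RL w' is n :: s then
      if a == head a w' then n.+1 :: s else [:: 1%N, n & s]
    else [:: 1%N]
  else [::].

Section Qumterval.
Variable R : realType.

(* The convergent [0; a 0, ..., a n.-1]. *)
Fixpoint cf_convergent (a : nat -> nat) (n : nat) : R :=
  if n is n'.+1 then ((a 0%N)%:R + cf_convergent (fun i => a i.+1) n')^-1
  else 0.

Definition cf (a : nat -> nat) : R :=
  lim (cf_convergent a n @[n --> \oo])%classic.

Definition periodic_cf (S : seq nat) : R :=
  cf (fun i => nth 0%N S (i %% size S)).

Definition qum_right (w : word) : R := periodic_cf (RL w).
Definition qum_left (w : word) : R := 1 - periodic_cf (rev (RL w)).

Definition qumterval (w : word) : interval R :=
  `]qum_left w, qum_right w[.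

End Qumterval.

Record SL2Z := MkSL2Z { SL2Z_mx :> 'M[int]_2; _ : \det SL2Z_mx == 1 }.

HB.instance Definition _ := [isSub for SL2Z_mx].
HB.instance Definition _ := [Choice of SL2Z by <:].

Lemma SL2Z_det (A : SL2Z) : \det A = 1.
Proof. exact/eqP/(valP A). Qed.

Lemma SL2Z_unit (A : SL2Z) : (A : 'M[int]_2) \is a GRing.unit.
Proof. by rewrite unitmxE SL2Z_det unitr1. Qed.

Lemma SL2Z_one_proof : \det (1 : 'M[int]_2) == 1.
Proof. by rewrite det1. Qed.

Lemma SL2Z_mul_proof (A B : SL2Z) : \det ((A : 'M[int]_2) * B) == 1.
Proof. by rewrite detM !SL2Z_det mulr1. Qed.

Lemma SL2Z_inv_proof (A : SL2Z) : \det (A : 'M[int]_2)^-1 == 1.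
Proof. by rewrite detV SL2Z_det invr1. Qed.

Lemma SL2Z_opp_proof (A : SL2Z) : \det (- (A : 'M[int]_2)) == 1.
Proof. by rewrite -scaleN1r detZ SL2Z_det sqrrN !mulr1. Qed.

Definition SL2Z_one : SL2Z := MkSL2Z SL2Z_one_proof.
Definition SL2Z_mul (A B : SL2Z) : SL2Z := MkSL2Z (SL2Z_mul_proof A B).
Definition SL2Z_inv (A : SL2Z) : SL2Z := MkSL2Z (SL2Z_inv_proof A).
Definition SL2Z_opp (A : SL2Z) : SL2Z := MkSL2Z (SL2Z_opp_proof A).

Lemma SL2Z_mulA : associative SL2Z_mul.
Proof. by move=> A B C; apply/val_inj/mulrA. Qed.

Lemma SL2Z_mul1l : left_id SL2Z_one SL2Z_mul.
Proof. by move=> A; apply/val_inj/mul1r. Qed.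

Lemma SL2Z_mul1r : right_id SL2Z_one SL2Z_mul.
Proof. by move=> A; apply/val_inj/mulr1. Qed.

Lemma SL2Z_mulVl : left_inverse SL2Z_one SL2Z_inv SL2Z_mul.
Proof. by move=> A; apply/val_inj/mulVr/SL2Z_unit. Qed.

Lemma SL2Z_mulVr : right_inverse SL2Z_one SL2Z_inv SL2Z_mul.
Proof. by move=> A; apply/val_inj/mulrV/SL2Z_unit. Qed.

HB.instance Definition _ := isGroup.Build SL2Z
  SL2Z_mulA SL2Z_mul1l SL2Z_mul1r SL2Z_mulVl SL2Z_mulVr.

Definition eq_up_to_sign (A B : SL2Z) : bool := (A == B) || (A == SL2Z_opp B).

Lemma SL2Z_oppK : involutive SL2Z_opp.
Proof. by move=> A; apply/val_inj/opprK. Qed.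

Lemma eq_up_to_sign_refl : reflexive eq_up_to_sign.
Proof. by move=> A; rewrite /eq_up_to_sign eqxx. Qed.

Lemma eq_up_to_sign_sym : symmetric eq_up_to_sign.
Proof.
move=> A B; rewrite /eq_up_to_sign [B == A]eq_sym; congr (_ || _).
by apply/eqP/eqP => ->; rewrite SL2Z_oppK.
Qed.

Lemma eq_up_to_sign_trans : transitive eq_up_to_sign.
Proof.
move=> B A C /orP[] /eqP-> /orP[] /eqP->; rewrite /eq_up_to_sign ?SL2Z_oppK ?eqxx ?orbT //.
Qed.

Canonical eq_up_to_sign_equiv :=
  EquivRel eq_up_to_sign eq_up_to_sign_refl eq_up_to_sign_sym eq_up_to_sign_trans.

Definition PSL2Z := {eq_quot eq_up_to_sign}.
HB.instance Definition _ := Choice.on PSL2Z.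
HB.instance Definition _ := EqQuotient.on PSL2Z.

Definition toPSL (A : SL2Z) : PSL2Z := \pi_PSL2Z A.

Definition PSL2Z_one : PSL2Z := toPSL SL2Z_one.
Definition PSL2Z_mul (x y : PSL2Z) : PSL2Z := toPSL (SL2Z_mul (repr x) (repr y)).
Definition PSL2Z_inv (x : PSL2Z) : PSL2Z := toPSL (SL2Z_inv (repr x)).

Lemma toPSL_eq (A B : SL2Z) : reflect (toPSL A = toPSL B) (eq_up_to_sign A B).
Proof. by apply: (iffP idP) => [/eqmodP//|/eqmodP]. Qed.

Lemma reprPSL (x : PSL2Z) : toPSL (repr x) = x.
Proof. exact: reprK. Qed.

Lemma toPSL_mul (A B : SL2Z) :
  PSL2Z_mul (toPSL A) (toPSL B) = toPSL (SL2Z_mul A B).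
Proof.
have /toPSL_eq hA := reprPSL (toPSL A); have /toPSL_eq hB := reprPSL (toPSL B).
apply/toPSL_eq; move: hA hB => /orP[] /eqP-> /orP[] /eqP->; apply/orP.
- by left.
- by right; apply/eqP/val_inj; rewrite /= mulrN.
- by right; apply/eqP/val_inj; rewrite /= mulNr.
- by left; apply/eqP/val_inj; rewrite /= mulrNN.
Qed.

Lemma toPSL_inv (A : SL2Z) : PSL2Z_inv (toPSL A) = toPSL (SL2Z_inv A).
Proof.
have /toPSL_eq hA := reprPSL (toPSL A).
apply/toPSL_eq; move: hA => /orP[] /eqP->; apply/orP; first by left.
by right; apply/eqP/val_inj; rewrite /= invrN.
Qed.

Lemma PSL2Z_mulA : associative PSL2Z_mul.
Proof.
by move=> x y z; rewrite -(reprPSL x) -(reprPSL y) -(reprPSL z) !toPSL_mul SL2Z_mulA.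
Qed.

Lemma PSL2Z_mul1l : left_id PSL2Z_one PSL2Z_mul.
Proof. by move=> x; rewrite -(reprPSL x) toPSL_mul SL2Z_mul1l. Qed.

Lemma PSL2Z_mul1r : right_id PSL2Z_one PSL2Z_mul.
Proof. by move=> x; rewrite -(reprPSL x) toPSL_mul SL2Z_mul1r. Qed.

Lemma PSL2Z_mulVl : left_inverse PSL2Z_one PSL2Z_inv PSL2Z_mul.
Proof. by move=> x; rewrite -(reprPSL x) toPSL_inv toPSL_mul SL2Z_mulVl. Qed.

Lemma PSL2Z_mulVr : right_inverse PSL2Z_one PSL2Z_inv PSL2Z_mul.
Proof. by move=> x; rewrite -(reprPSL x) toPSL_inv toPSL_mul SL2Z_mulVr. Qed.

HB.instance Definition _ := isGroup.Build PSL2Z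
  PSL2Z_mulA PSL2Z_mul1l PSL2Z_mul1r PSL2Z_mulVl PSL2Z_mulVr.

Lemma toPSLM (A B : SL2Z) : toPSL (A * B)%g = (toPSL A * toPSL B)%g.
Proof. by rewrite [RHS]toPSL_mul. Qed.

Lemma toPSLV (A : SL2Z) : toPSL (A^-1)%g = ((toPSL A)^-1)%g.
Proof. by rewrite [RHS]toPSL_inv. Qed.

Definition mx2 (a b c d : int) : 'M[int]_2 :=
  \matrix_(i, j) (if i == 0 then (if j == 0 then a else b)
                  else (if j == 0 then c else d)).

Lemma det_mx2 a b c d : \det (mx2 a b c d) = a * d - b * c.
Proof.
rewrite (expand_det_row _ ord0) !big_ord_recl big_ord0 addr0.
by rewrite /cofactor !det_mx11 !mxE /= expr0 expr1 mul1r mulN1r mulrN.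
Qed.

Lemma det_S : \det (mx2 0 (-1) 1 0) == 1.
Proof. by rewrite det_mx2. Qed.

Lemma det_T : \det (mx2 1 1 0 1) == 1.
Proof. by rewrite det_mx2. Qed.

Lemma det_digit (c : int) : \det (mx2 0 (-1) 1 c) == 1.
Proof. by rewrite det_mx2 mul0r sub0r mulN1r opprK. Qed.

Definition matS : PSL2Z := toPSL (MkSL2Z det_S).
Definition matT : PSL2Z := toPSL (MkSL2Z det_T).
Definition digit_mat (c : int) : PSL2Z := toPSL (MkSL2Z (det_digit c)).

Section Maps.
Variable R : realType.

(* The digit of 0 is undefined; here it gets a junk value, since 0^-1 = 0. *)
Definition digit (alpha x : R) : int := Num.floor (- x^-1 + 1 - alpha).

Definition K (alpha x : R) : R :=
  if x == 0 then 0 else - x^-1 - (digit alpha x)%:~R.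

Definition digit_at (j : nat) (alpha x : R) : int :=
  digit alpha (iter j.-1 (K alpha) x).

Definition Mmat (alpha x : R) (l : nat) : PSL2Z :=
  (\big[*%g/1%g]_(1 <= j < l.+1) digit_mat (digit_at j alpha x))%g.

(* The digits c_1, ..., c_l of x are all genuine, i.e. taken at nonzero points;
   this is what makes the product [Mmat alpha x l] meaningful. *)
Definition digits_defined (alpha x : R) (l : nat) : Prop :=
  forall j, (1 <= j <= l)%N -> iter j.-1 (K alpha) x != 0.

End Maps.

(* Main.v *)
Require Import Defs.
From mathcomp Require Import all_boot all_order all_algebra.
From mathcomp Require Import all_classical all_reals all_analysis.
From mathcomp Require Import ring lra zify.

(** Let the letters act on positive numbers by [0 : t -> t / (1 + t)] and
    [1 : t -> t + 1], and words by composition.  Both maps are increasing and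
    the image of 0 lies below the image of 1, so the order on expansions is
    the lexicographic one ([branches_diverge]), and a word beginning with 0
    and ending with 1 has as fixed point the periodic continued fraction of
    its run lengths ([cf_eval_RL], [periodic_cf_fixpoint]).

    A Farey word other than 0 and 1 has the form w = 0p1, where p is a
    palindrome, and w and its dual (the complement of its reverse) are Lyndon
    words ([farey_pair_palindrome], [farey_pair_lyndon]).  The right end of
    the qumterval is the fixed point of w, and the left end is one minus that
    of the dual of w.  Every alpha between them expands as 0p followed by some
    z.  In the coordinate [x + 1], the orbit of [alpha - 1] under K_alpha
    starts at alpha and undoes the letters of 0p: undoing 0 is x -> -1/x - 2,
    undoing 1 is x -> x - 1, and one step of K_alpha undoes a block 01^k with
    digit k + 2, provided that the point reached remains in the domain.  These
    constraints say that alpha < s(z) for every suffix s of p and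
    z < 1 + alpha; they follow from the Lyndon properties and from contraction
    ([orbit_bounds]).  Hence the digits of [alpha - 1] are read on 0p and do not
    depend on alpha.  The orbit of alpha is the mirror image of this one, with
    [1 - alpha] and the dual word, so its digits are the negatives of those read
    on 0 followed by the complement of p.

    So M is the product of the letters of 0p under 0 -> ST^2, 1 -> T, and M' is
    the product of the letters of 1p under 0 -> T^-1, 1 -> ST^-2; that the same
    p occurs in both is the palindrome property.  The two substitutions are
    conjugate by STS, which gives the matching relation ([matching]). *)

Import Order.TTheory GRing.Theory Num.Theory.
Import numFieldNormedType.Exports.

Set Implicit Arguments.
Unset Strict Implicit.
Unset Printing Implicit Defensive.

Local Open Scope ring_scope.

(** * Lexicographic order and Lyndon words *)

Section Lex.

Fixpoint lexlt (u v : word) : bool :=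
  match u, v with
  | _, [::] => false
  | [::], _ :: _ => true
  | a :: u', b :: v' => if a == b then lexlt u' v' else b
  end.

Lemma lexlt_trans : transitive lexlt.
Proof.
elim=> [|b v IH] [|a u] [|c t] //=.
by case: a b c => [] [] [] //=; exact: IH.
Qed.

Lemma lexlt_cat2l c u v : lexlt (c ++ u) (c ++ v) = lexlt u v.
Proof. by elim: c => //= a c ->; rewrite eqxx. Qed.

(** Strict order decided at a letter where both words are defined.  Unlike a
    comparison in which one word is a proper prefix of the other, it survives
    arbitrary continuations of both words, and this is what makes it visible
    on the reals (see [branches_diverge]). *)
Definition diverge (u v : word) :=
  exists c s t, u = c ++ false :: s /\ v = c ++ true :: t.

Lemma lexlt_diverge u v :
  lexlt u v -> diverge u v \/ exists2 s, s != [::] & v = u ++ s.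
Proof.
elim: u v => [|a u IH] [|b v] //=; first by right; exists (b :: v).
case: (a =P b) => [->|nab].
  case/IH => [[c [s [t [-> ->]]]]|[s s0 ->]]; last by right; exists s.
  by left; exists (b :: c), s, t.
by case: a b nab => [] [] // _ _; left; exists [::], u, v.
Qed.

Lemma diverge_lexlt u v : diverge u v -> lexlt u v.
Proof. by move=> [c [s [t [-> ->]]]]; rewrite lexlt_cat2l. Qed.

Lemma diverge_cat u v u' v' : diverge u v -> diverge (u ++ u') (v ++ v').
Proof.
by move=> [c [s [t [-> ->]]]]; exists c, (s ++ u'), (t ++ v'); rewrite -!catA.
Qed.

Lemma lexlt_short_diverge u v :
  (size v <= size u)%N -> lexlt u v -> diverge u v.
Proof.
move=> suv /lexlt_diverge[//|[s s0 vE]].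
by move: suv; rewrite vE size_cat leqNgt -addn1 leq_add2l lt0n size_eq0 s0.
Qed.

Definition lyndon (w : word) :=
  forall q s, q != [::] -> s != [::] -> w = q ++ s -> lexlt w s.

(** A suffix of [w] is too short to have [w] as a proper prefix, so the
    comparison with a Lyndon word is decided at a letter. *)
Lemma lyndon_diverge w q s :
  lyndon w -> q != [::] -> s != [::] -> w = q ++ s -> diverge w s.
Proof.
move=> lw q0 s0 wE; apply: lexlt_short_diverge; last exact: lw wE.
by rewrite wE size_cat leq_addl.
Qed.

(** If [u] is a prefix of [v], cancel it and use that [v] precedes its own
    suffix. *)
Lemma lyndon_cat u v : u != [::] -> v != [::] ->
  lyndon u -> lyndon v -> lexlt u v -> lexlt (u ++ v) v.
Proof.
move=> u0 v0 lu lv /lexlt_diverge[uv|[s s0 vE]].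
  by apply: diverge_lexlt; rewrite -[X in diverge _ X]cats0; apply: diverge_cat.
by rewrite [X in lexlt _ X]vE lexlt_cat2l; apply: (lv u).
Qed.

Lemma cat_eq_cat (u v q s : word) : u ++ v = q ++ s ->
  (exists r, q = u ++ r /\ v = r ++ s) \/
  (exists r, [/\ r != [::], u = q ++ r & s = r ++ v]).
Proof.
elim: u q => [|a u IH] [|b q] /=; try by move=> <-; left; exists [::].
- by move=> ->; left; exists (b :: q).
- by move=> <-; right; exists (a :: u).
case=> -> /IH [[r [-> ->]]|[r [r0 -> ->]]]; first by left; exists r.
by right; exists r.
Qed.

Lemma lyndon_catP u v : u != [::] -> v != [::] ->
  lyndon u -> lyndon v -> lexlt u v -> lyndon (u ++ v).
Proof.
move=> u0 v0 lu lv uv q s q0 s0 /cat_eq_cat.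
have uvv := lyndon_cat u0 v0 lu lv uv.
case=> [[r [_ vE]]|[r [r0 uE sE]]].
  case: (eqVneq r [::]) vE => [->|r0] vE; first by rewrite -[s]/([::] ++ s) -vE.
  by apply: lexlt_trans uvv _; apply: (lv r).
rewrite sE; apply: diverge_lexlt; apply: diverge_cat.
exact: lyndon_diverge uE.
Qed.

End Lex.

(** * Farey words *)

Section Farey.

(** Duality is the symmetry of the problem: it corresponds to the change of
    parameter [alpha -> 1 - alpha]. *)
Definition dual (w : word) : word := rev (map negb w).

Lemma dual_cat u v : dual (u ++ v) = dual v ++ dual u.
Proof. by rewrite /dual map_cat rev_cat. Qed.

(** The pairs of neighbours in the lists F_n. *)
Inductive farey_pair : word -> word -> Prop :=
| FareyBase : farey_pair [:: false] [:: true]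
| FareyLeft u v of farey_pair u v : farey_pair u (u ++ v)
| FareyRight u v of farey_pair u v : farey_pair (u ++ v) v.

Record lyndon_pair (u v : word) : Prop := LyndonPair {
  lyndon_pair_l0 : u != [::];
  lyndon_pair_r0 : v != [::];
  lyndon_pair_l : lyndon u;
  lyndon_pair_r : lyndon v;
  lyndon_pair_lt : lexlt u v }.

Lemma lexlt_catr u v : v != [::] -> lexlt u (u ++ v).
Proof. by rewrite -{1}[u]cats0 lexlt_cat2l; case: v. Qed.

Lemma lyndon_pair_left u v : lyndon_pair u v -> lyndon_pair u (u ++ v).
Proof.
case=> u0 v0 lu lv uv; split=> //; last exact: lexlt_catr.
  by rewrite -size_eq0 size_cat addn_eq0 !size_eq0 (negbTE u0).
exact: lyndon_catP.
Qed.

Lemma lyndon_pair_right u v : lyndon_pair u v -> lyndon_pair (u ++ v) v.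
Proof.
case=> u0 v0 lu lv uv; split=> //; last exact: lyndon_cat.
  by rewrite -size_eq0 size_cat addn_eq0 !size_eq0 (negbTE u0).
exact: lyndon_catP.
Qed.

Lemma lyndon1 a : lyndon [:: a].
Proof. by move=> [|b [|c q]] // [|d s]. Qed.

(** Duality exchanges the two ways to refine a pair, so the Lyndon property
    propagates simultaneously to the words and to their duals. *)
Lemma farey_pair_lyndon u v :
  farey_pair u v -> lyndon_pair u v /\ lyndon_pair (dual v) (dual u).
Proof.
elim=> [|{}u {}v _ [IH1 IH2]|{}u {}v _ [IH1 IH2]].
- by split; split=> //; exact: lyndon1.
- rewrite dual_cat; split; first exact: lyndon_pair_left.
  exact: lyndon_pair_right.
- rewrite dual_cat; split; first exact: lyndon_pair_right.
  exact: lyndon_pair_left.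
Qed.

Fixpoint farey_chain (u : word) (l : seq word) : Prop :=
  if l is v :: l' then farey_pair u v /\ farey_chain v l' else True.

Lemma farey_insert_chain u l : farey_chain u l ->
  exists l', [/\ farey_insert (u :: l) = u :: l', farey_chain u l' &
    forall w, w \in l' ->
      w \in l \/ exists x y, farey_pair x y /\ w = x ++ y].
Proof.
elim: l u => [|v l IH] u; first by exists [::].
have -> : farey_insert [:: u, v & l] = [:: u, u ++ v & farey_insert (v :: l)] by [].
case=> uv /IH [l' [-> chl' inl']].
exists ((u ++ v) :: v :: l'); split=> //=.
  by split; [exact: FareyLeft|split; first exact: FareyRight].
move=> w; rewrite !inE => /or3P[/eqP->|/eqP->|/inl'[wl|?]].
- by right; exists u, v.
- by left; rewrite eqxx.
- by left; rewrite wl orbT.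
- by right.
Qed.

Lemma FWstar_farey_pair w :
  FWstar w -> exists u v, farey_pair u v /\ w = u ++ v.
Proof.
case=> -[n wn] w0 w1.
suff: exists l, [/\ farey_list n = [:: false] :: l, farey_chain [:: false] l &
    forall w, w \in l ->
      w = [:: true] \/ exists x y, farey_pair x y /\ w = x ++ y].
  case=> l [nE _ lP]; move: wn; rewrite nE inE => /orP[/eqP//|/lP[//|]].
  by [].
elim: n {wn} => [|n [l [nE chl lP]]].
  exists [:: [:: true]]; split=> //=; first by split; first exact: FareyBase.
  by move=> x; rewrite inE => /eqP; left.
have [l' [lE chl' lP']] := farey_insert_chain chl.
exists l'; split=> //; first by rewrite /farey_list iterS -/(farey_list n) nE.
by move=> x /lP'[/lP|]; [|right].
Qed.

Definition subst (a b : word) (w : word) : word :=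
  flatten [seq if x then b else a | x <- w].

Lemma subst_cat a b u v : subst a b (u ++ v) = subst a b u ++ subst a b v.
Proof. by rewrite /subst map_cat flatten_cat. Qed.

Lemma subst_cons a b x u :
  subst a b (x :: u) = (if x then b else a) ++ subst a b u.
Proof. by []. Qed.

Local Notation U0 := (subst [:: false] [:: false; true]).
Local Notation U1 := (subst [:: false; true] [:: true]).

(** The same pairs are obtained by substituting in the whole pair instead of
    concatenating its members.  Concatenation is adapted to the Lyndon
    property, substitution to the palindrome property. *)
Inductive subst_pair : word -> word -> Prop :=
| SubstBase : subst_pair [:: false] [:: true]
| SubstU0 u v of subst_pair u v : subst_pair (U0 u) (U0 v)
| SubstU1 u v of subst_pair u v : subst_pair (U1 u) (U1 v).

Lemma subst_pair_step u v :
  subst_pair u v -> subst_pair u (u ++ v) /\ subst_pair (u ++ v) v.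
Proof.
elim=> [|{}u {}v _ [IH1 IH2]|{}u {}v _ [IH1 IH2]].
- by split; [exact: (SubstU0 SubstBase)|exact: (SubstU1 SubstBase)].
- by rewrite -subst_cat; split; exact: SubstU0.
- by rewrite -subst_cat; split; exact: SubstU1.
Qed.

Lemma farey_pair_subst u v : farey_pair u v -> subst_pair u v.
Proof.
elim=> [|u' v' _ /subst_pair_step[]|u' v' _ /subst_pair_step[]] //.
exact: SubstBase.
Qed.

Lemma rev_U0 u : false :: rev (U0 u) = rcons (U0 (rev u)) false.
Proof.
elim: u => //= a u IH.
rewrite subst_cons rev_cat -cat_cons IH rev_cons -[rcons (rev u) a]cats1.
rewrite subst_cat -!cats1 -!catA.
by case: a.
Qed.

Lemma rev_U1 u : rcons (rev (U1 u)) true = true :: U1 (rev u).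
Proof.
elim: u => //= a u IH.
rewrite subst_cons rev_cat rcons_cat rev_cons -[rcons (rev u) a]cats1 subst_cat.
by rewrite -cat_cons -IH cat_rcons; case: a.
Qed.

(** Up to a letter moved from one end to the other, both substitutions
    commute with reversal ([rev_U0], [rev_U1]); the new central words are
    U0(p)0 and 1U1(p). *)
Lemma farey_pair_palindrome u v : farey_pair u v ->
  exists p, u ++ v = false :: rcons p true /\ rev p = p.
Proof.
move/farey_pair_subst; elim=> [|{}u {}v _ [p [uvE pp]]|{}u {}v _ [p [uvE pp]]].
- by exists [::].
- exists (rcons (U0 p) false); rewrite -subst_cat uvE; split.
    by rewrite subst_cons -cats1 subst_cat -!cats1 -catA.
  by rewrite rev_rcons rev_U0 pp.
- exists (true :: U1 p); rewrite -subst_cat uvE; split.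
    by rewrite subst_cons -cats1 subst_cat -!cats1.
  by rewrite rev_cons rev_U1 pp.
Qed.

End Farey.

(** * Run lengths *)

Section RunLengths.

Lemma RL_eq0 u : (RL u == [::]) = (u == [::]).
Proof. by case: u => //= a u; case: (RL u) => //= n s; case: ifP. Qed.

Lemma RL_cat u v a b : u != [::] -> v != [::] -> last a u != head b v ->
  RL (u ++ v) = RL u ++ RL v.
Proof.
elim: u a => // c u IH a _ v0 /=.
case: (eqVneq u [::]) => [->|u0] /= cv.
  case E: (RL v) => [|n s]; first by move/eqP: E; rewrite RL_eq0 (negbTE v0).
  by case: v v0 cv {E IH} => // d v _ /= /negbTE ->.
rewrite (IH c) //; case E: (RL u) => [|n s].
  by move/eqP: E; rewrite RL_eq0 (negbTE u0).
have ->: head c (u ++ v) = head c u by case: (u) u0.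
by rewrite /=; case: ifP.
Qed.

Lemma RL_cat_merge u v a b s m n t : last a u = head b v ->
  RL u = rcons s m -> RL v = n :: t -> RL (u ++ v) = s ++ (m + n)%N :: t.
Proof.
elim: u a s m => [|c u IH] a s m; first by case: s.
have v0 : RL v = n :: t -> v != [::] by case: (v).
move=> /= cv + vE.
case: (eqVneq u [::]) cv => [->|u0] /= cv.
  case: s => [|? []] // [<-]; rewrite vE.
  by case: v v0 cv vE {IH} => [/(_ _)|d v _ /= -> _]; rewrite ?eqxx.
have ->: head c (u ++ v) = head c u by case: (u) u0.
case E: (RL u) => [|k r].
  by move/eqP: E; rewrite RL_eq0 (negbTE u0).
case/lastP: r E => [|r k'] E.
  rewrite (IH c [::] k) //=.
  case: ifP => _; first by case: s => [|? []] // [<-].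
  by case: s => [|? [|? []]] // [<- <-].
rewrite (IH c (k :: r) k') //=.
case: ifP => _.
  by rewrite -rcons_cons => /rcons_inj[<- <-].
by rewrite -!rcons_cons => /rcons_inj[<- <-].
Qed.

(** Adding a letter at the end of the reversed word either starts a new run
    ([RL_cat]) or lengthens the last one ([RL_cat_merge]). *)
Lemma RL_rev u : RL (rev u) = rev (RL u).
Proof.
elim: u => // a u IH; rewrite rev_cons -cats1 /=.
case: (eqVneq u [::]) => [->|u0] //.
have ru0: rev u != [::] by rewrite -size_eq0 size_rev size_eq0.
case E: (RL u) => [|n s]; first by move/eqP: E; rewrite RL_eq0 (negbTE u0).
have lE : last a (rev u) = head a u.
  by case: (u) u0 => // b u' _; rewrite rev_cons last_rcons.
case: ifP => [/eqP aE|/negbT aE].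
  rewrite (@RL_cat_merge _ _ a a (rev s) n 1 [::]) ?lE -?aE //.
    by rewrite rev_cons addn1 cats1.
  by rewrite IH E rev_cons.
by rewrite (@RL_cat _ _ a a) // ?lE 1?eq_sym // IH E [RHS]rev_cons cats1.
Qed.

Lemma RL_negb u : RL (map negb u) = RL u.
Proof.
elim: u => // a u IH /=; rewrite IH; case: (RL u) => // n s.
suff ->: (~~ a == head (~~ a) (map negb u)) = (a == head a u) by [].
by case: u {IH} => [|b u] /=; rewrite ?eqxx //; case: a; case: b.
Qed.

Lemma RL_dual u : RL (dual u) = rev (RL u).
Proof. by rewrite RL_rev RL_negb. Qed.

Lemma RL_gt0 u : all (leq 1) (RL u).
Proof.
elim: u => //= a u; case: (RL u) => //= n s IH.
by case: ifP => _ //=; case/andP: IH.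
Qed.

End RunLengths.

(** * The action of words on positive numbers *)

Section Branches.
Variable R : realFieldType.
Implicit Types (t x y : R) (q : word).

(** The inverse branches of the Farey map of the half-line: their images are
    [0, 1) and [1, +oo), in the order of the two digits. *)
Definition branch (b : bool) t := if b then t + 1 else t / (1 + t).
Definition branches q t := foldr branch t q.

Lemma branches_cat q1 q2 t : branches (q1 ++ q2) t = branches q1 (branches q2 t).
Proof. exact: foldr_cat. Qed.

Lemma branches_rcons q b t : branches (rcons q b) t = branches q (branch b t).
Proof. exact: foldr_rcons. Qed.

Lemma branch_ge0 b t : 0 <= t -> 0 <= branch b t.
Proof. by move=> t0; case: b => /=; [lra|apply: divr_ge0; lra]. Qed.

Lemma branches_ge0 q t : 0 <= t -> 0 <= branches q t.
Proof. by move=> t0; elim: q => //= b q; exact: branch_ge0. Qed.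

Lemma branch0_lt1 t : 0 <= t -> branch false t < 1.
Proof. by move=> t0; rewrite /= ltr_pdivrMr; lra. Qed.

Lemma branch_sub b x y : 0 <= x -> x < y ->
  0 < branch b y - branch b x <= y - x.
Proof.
move=> x0 xy; case: b => /=; first lra.
have -> : y / (1 + y) - x / (1 + x) = (y - x) / ((1 + x) * (1 + y)).
  by field; apply/andP; split; lra.
have p0 : 0 < (1 + x) * (1 + y) by apply: mulr_gt0; lra.
rewrite divr_gt0 //=; last lra.
by rewrite ler_pdivrMr // ler_peMr; nra.
Qed.

Lemma branches_sub q x y : 0 <= x -> x < y ->
  0 < branches q y - branches q x <= y - x.
Proof.
move=> x0 xy; elim: q => [|b q /andP[q1 q2]] /=; first lra.
have /andP[-> h] : 0 < branch b (branches q y) - branch b (branches q x)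
    <= branches q y - branches q x.
  by apply: branch_sub; [exact: branches_ge0|lra].
exact: le_trans q2.
Qed.

Lemma branches_lt q x y : 0 <= x -> x < y -> branches q x < branches q y.
Proof. by move=> x0 /(branches_sub q x0)/andP[]; rewrite subr_gt0. Qed.

Lemma branches_gt0 q t : 0 < t -> 0 < branches q t.
Proof.
by move/(branches_lt q (lexx 0)); apply: le_lt_trans; exact: branches_ge0.
Qed.

Lemma branches_le q x y : 0 <= x -> x <= y -> branches q x <= branches q y.
Proof. by move=> x0; rewrite le_eqVlt => /predU1P[->//|/(branches_lt q x0)/ltW]. Qed.

(** Both branches are weak contractions, and the branch of 0 a strict one. *)
Lemma branches0_contract q x y : 0 <= x -> x < y ->
  branches (false :: q) y - branches (false :: q) x < y - x.
Proof.
move=> x0 xy; have /andP[q1 q2] := branches_sub q x0 xy.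
have u0 := branches_ge0 q x0.
apply: lt_le_trans q2.
rewrite /=; set u := branches q x in u0 q1 *; set v := branches q y in q1 *.
have -> : v / (1 + v) - u / (1 + u) = (v - u) / ((1 + u) * (1 + v)).
  by field; apply/andP; split; lra.
rewrite ltr_pdivrMr; last by apply: mulr_gt0; lra.
by rewrite ltr_pMr //; nra.
Qed.

Lemma branches_diverge u v x y : 0 <= x -> 0 <= y ->
  diverge u v -> branches u x < branches v y.
Proof.
move=> x0 y0 [c [s [t [-> ->]]]]; rewrite !branches_cat.
apply: branches_lt; first exact/branches_ge0.
apply: lt_le_trans (branch0_lt1 _) _; first exact: branches_ge0.
by rewrite /= lerDr; exact: branches_ge0.
Qed.

Lemma branches_between q x y a : 0 <= x -> 0 <= y ->
  branches q x < a < branches q y -> exists2 z, a = branches q z & x < z < y.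
Proof.
move=> x0 y0; elim: q a => [|b q IH] a /=; first by exists a.
have u0 := branches_ge0 q x0; have v0 := branches_ge0 q y0.
move=> /andP[xa ay].
suff [a' -> /IH[z -> zxy]] : exists2 a', a = branch b a' &
   branches q x < a' < branches q y by exists z.
move: u0 v0 xa ay; set u := branches q x; set v := branches q y => u0 v0.
case: b => /= xa ay; first by exists (a - 1); [ring|lra].
have va : a * (1 + v) < v by rewrite -ltr_pdivlMr //; lra.
have ua : u < a * (1 + u) by rewrite -ltr_pdivrMr //; lra.
have a1 : a < 1 by nra.
exists (a / (1 - a)); first by field; apply/andP; split; lra.
by rewrite ltr_pdivlMr ?ltr_pdivrMr; lra.
Qed.

(** The inversion [t -> 1 / t] exchanges the two branches. *)
Lemma branches_negb q t : 0 < t ->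
  branches (map negb q) t^-1 = (branches q t)^-1.
Proof.
move=> t0; elim: q => //= b q ->.
have := branches_gt0 q t0; move: (branches q t) => u u0.
by case: b => /=; field; apply/andP; split; lra.
Qed.

Definition cf_eval (S : seq nat) t := foldr (fun a t => (a%:R + t)^-1) t S.
#[global] Arguments cf_eval : simpl never.

Lemma cf_eval_cons a S t : cf_eval (a :: S) t = (a%:R + cf_eval S t)^-1.
Proof. by []. Qed.

Lemma cf_eval_ge0 S t : 0 <= t -> 0 <= cf_eval S t.
Proof.
by move=> t0; elim: S => // a S S0; rewrite cf_eval_cons invr_ge0 addr_ge0.
Qed.

(** Dictionary between words and continued fractions: a run 0^a acts by
    [t -> 1 / (a + 1 / t)], a run 1^b by [t -> b + t]; since the last letter is
    1, the alternation ends on [t] itself. *)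
Lemma cf_eval_RL w t : w != [::] -> last true w -> 0 <= t ->
  cf_eval (RL w) t = (if head false w then (branches w t)^-1 else branches w t).
Proof.
move=> + + t0; elim: w => // b w IH _ wl.
case: (eqVneq w [::]) wl => [->|w0] /= wl; first by rewrite wl /= addrC.
have {}IH : cf_eval (RL w) t =
    (if head false w then (branches w t)^-1 else branches w t).
  by apply: IH => //; case: (w) w0 wl.
have u0 := branches_ge0 w t0; move: IH.
case E: (RL w) => [|n s] /=; first by move/eqP: E; rewrite RL_eq0 (negbTE w0).
move: (branches w t) u0 => u u0.
have n0 : (0 : R) < n%:R.
  have := RL_gt0 w; rewrite E => /= /andP[]; by rewrite ltr0n.
have v0 := cf_eval_ge0 s t0; rewrite cf_eval_cons.
have -> : cf_eval (if b == head b w then n.+1 :: s else [:: 1%N, n & s]) t =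
    if b == head b w then (n.+1%:R + cf_eval s t)^-1
    else (1 + (n%:R + cf_eval s t)^-1)^-1 by case: ifP.
have -> : head b w = head false w by case: (w) w0.
move: (cf_eval s t) v0 => v v0 IH; case: b {wl}; case: (head false w) IH => /= IH.
- have -> : u = n%:R + v by rewrite -[LHS]invrK -IH invrK.
  by congr (_^-1); rewrite -natr1; ring.
- by rewrite IH addrC.
- have -> : u = n%:R + v by rewrite -[LHS]invrK -IH invrK.
  by field; apply/andP; split; lra.
- by rewrite -IH -natr1; field; apply/andP; split; lra.
Qed.

End Branches.

(** * Periodic continued fractions *)

Section ContinuedFractions.
Variable R : realType.
Local Open Scope classical_set_scope.

Lemma cf_convergent_itv (a : nat -> nat) n : (forall i, (0 < a i)%N) ->
  0 <= cf_convergent R a n <= 1.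
Proof.
elim: n a => [|n IH] a a0 /=; first by rewrite lexx ler01.
have /andP[c0 _] := IH (fun i => a i.+1) (fun i => a0 i.+1).
have a1 : (1 : R) <= (a 0%N)%:R by rewrite ler1n.
by rewrite invr_ge0 invf_le1; lra.
Qed.

Lemma cf_convergent_step (a : nat -> nat) (x : nat -> R) n :
  (forall i, (0 < a i)%N) -> (forall i, 0 < x i) ->
  (forall i, x i = ((a i)%:R + x i.+1)^-1) ->
  `|cf_convergent R a n.+1 - x 0%N|
    <= x 0%N * `|cf_convergent R (fun i => a i.+1) n - x 1%N|.
Proof.
move=> a0 x0 xE /=.
have /andP[c0 _] := cf_convergent_itv n (fun i => a0 i.+1).
have a1 : (1 : R) <= (a 0%N)%:R by rewrite ler1n.
have x1 := x0 1%N.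
rewrite {1}(xE 0%N); move: (cf_convergent _ _ _) c0 => c c0.
have -> : ((a 0%N)%:R + c)^-1 - ((a 0%N)%:R + x 1%N)^-1 =
   x 0%N * (((a 0%N)%:R + c)^-1 * (x 1%N - c)).
  by rewrite (xE 0%N); field; apply/andP; split; lra.
rewrite normrM (gtr0_norm (x0 0%N)) ler_pM2l // normrM distrC.
rewrite ler_piMl // ger0_norm ?invr_ge0 ?invf_le1; lra.
Qed.

(** With complete quotients [x i], one step contracts the error by [x 0]
    ([cf_convergent_step]), which may be close to 1; but two consecutive ones
    have product at most 1/2, and (3/4)^2 > 1/2. *)
Lemma cf_convergent_bound n (a : nat -> nat) (x : nat -> R) :
  (forall i, (0 < a i)%N) -> (forall i, 0 < x i) ->
  (forall i, x i = ((a i)%:R + x i.+1)^-1) ->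
  `|cf_convergent R a n - x 0%N| <= 2 * (3 / 4) ^+ n.
Proof.
move=> a0 x0 xE.
have x1 (y : nat -> R) b : (forall i, (0 < b i)%N) -> (forall i, 0 < y i) ->
    (forall i, y i = ((b i)%:R + y i.+1)^-1) -> forall i, y i <= 1.
  move=> b0 y0 yE i; rewrite yE; have := y0 i.+1.
  have b1 : (1 : R) <= (b i)%:R by rewrite ler1n.
  by move=> ?; rewrite invf_le1; lra.
suff : `|cf_convergent R a n - x 0%N| <= 2 * (3 / 4) ^+ n /\
   `|cf_convergent R a n.+1 - x 0%N| <= 2 * (3 / 4) ^+ n.+1 by case.
elim: n a x a0 x0 xE => [|n IH] a x a0 x0 xE.
  have := x0 0%N; have := x1 x a a0 x0 xE 0%N.
  have /andP := @cf_convergent_itv a 1 a0.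
  rewrite expr0 expr1 [cf_convergent R a 0]/= => -[? ?] ? ?.
  by split; rewrite ler_norml; lra.
split; first by have [] := IH a x a0 x0 xE.
have [IH1 _] := IH (fun i => a i.+2) (fun i => x i.+2)
  (fun i => a0 i.+2) (fun i => x0 i.+2) (fun i => xE i.+2).
have s1 := cf_convergent_step n.+1 a0 x0 xE.
have s2 := cf_convergent_step n (fun i => a0 i.+1) (fun i => x0 i.+1)
  (fun i => xE i.+1).
have p2 : x 0%N * x 1%N <= 1 / 2.
  have := x1 x a a0 x0 xE 1%N; have := x0 1%N.
  have b1 : (1 : R) <= (a 0%N)%:R by rewrite ler1n.
  by rewrite (xE 0%N) => ? ?; rewrite mulrC ler_pdivrMr; lra.
apply: le_trans s1 _.
apply: le_trans (ler_wpM2l (ltW (x0 0%N)) s2) _.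
rewrite mulrA.
apply: le_trans (ler_pM _ _ p2 IH1) _ => //; first by rewrite mulr_ge0 ?ltW.
have : 0 <= (3 / 4 : R) ^+ n by rewrite exprn_ge0; lra.
by rewrite !exprS; lra.
Qed.

Lemma cf_eq (a : nat -> nat) (x : nat -> R) :
  (forall i, (0 < a i)%N) -> (forall i, 0 < x i) ->
  (forall i, x i = ((a i)%:R + x i.+1)^-1) -> cf R a = x 0%N.
Proof.
move=> a0 x0 xE; apply/cvg_lim => //.
apply/cvgrPdist_le => e e0.
have /cvgrPdist_le /(_ e e0) : geometric (2 : R) (3 / 4) n @[n --> \oo] --> (0 : R).
  by apply: cvg_geometric; rewrite ger0_norm; lra.
apply: filterS => n /=; rewrite sub0r normrN => h.
rewrite distrC; apply: le_trans (cf_convergent_bound n a0 x0 xE) _.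
by apply: le_trans h; exact: ler_norm.
Qed.

Lemma cf_eval_gt0 (S : seq nat) (t : R) : all (leq 1) S -> 0 < t -> 0 < cf_eval S t.
Proof.
move=> S0 t0; elim: S S0 => // a S IH /= /andP[a0 /IH].
by rewrite cf_eval_cons invr_gt0 => ?; rewrite ltr_wpDl.
Qed.

(** The complete quotients are the values at [x] of the suffixes of the
    period. *)
Lemma periodic_cf_eq (S : seq nat) (x : R) : S != [::] -> all (leq 1) S ->
  0 < x -> cf_eval S x = x -> periodic_cf R S = x.
Proof.
move=> S0 Sp x0 xE; have nS : (0 < size S)%N by rewrite lt0n size_eq0.
pose y i := cf_eval (drop (i %% size S) S) x.
have -> : x = y 0%N by rewrite /y mod0n drop0.
apply: (@cf_eq _ y).
- by move=> i; apply: (allP Sp); apply: mem_nth; rewrite ltn_mod.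
- move=> i; apply: cf_eval_gt0 => //.
  by apply/allP => n /mem_drop; exact: (allP Sp).
- move=> i; have im : (i %% size S < size S)%N by rewrite ltn_mod.
  rewrite /y (drop_nth 0%N im) cf_eval_cons; congr (_ + _)^-1.
  rewrite -[in RHS]addn1 -modnDml addn1.
  move: im; rewrite leq_eqVlt => /predU1P[->|lt]; last by rewrite (modn_small lt).
  by rewrite modnn drop0 drop_size /= xE.
Qed.

Lemma cf_eval_continuous (S : seq nat) (t : R) : all (leq 1) S -> 0 <= t ->
  {for t, continuous (cf_eval S : R -> R)}.
Proof.
move=> + t0; elim: S => [_|a S IH /= /andP[a0 /IH {}IH]]; first exact: cvg_id.
have St := cf_eval_ge0 S t0; have a1 : (1 : R) <= a%:R by rewrite ler1n.
have p : a%:R + cf_eval S t != 0 by rewrite gt_eqF; lra.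
by apply: (cvgV p); apply: cvgD; [exact: cvg_cst|exact: IH].
Qed.

(** Intermediate value theorem on [0, 1]. *)
Lemma cf_eval_fixpoint (S : seq nat) : S != [::] -> all (leq 1) S ->
  exists2 x : R, 0 < x & cf_eval S x = x.
Proof.
move=> S0 Sp.
have le1 : cf_eval S (1 : R) <= 1.
  case: S S0 Sp => // a S _ /= /andP[a1 Sp].
  have := cf_eval_gt0 Sp ltr01; rewrite cf_eval_cons.
  have {}a1 : (1 : R) <= a%:R by rewrite ler1n.
  by move=> ?; rewrite invf_le1; lra.
have [||x] := @IVT R (fun x => cf_eval S x - x) 0 1 0 ler01.
- apply: continuous_in_subspaceT => x; rewrite inE /= in_itv /= => /andP[x0 _].
  by apply: cvgB; [exact: cf_eval_continuous|exact: cvg_id].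
- rewrite subr0; have := cf_eval_ge0 S (lexx (0 : R)).
  by rewrite ge_min le_max => ->; rewrite subr_le0 le1 !orbT.
rewrite in_itv /= => /andP[x0 _] /eqP; rewrite subr_eq0 => /eqP xE.
exists x => //; rewrite lt_neqAle x0 andbT; apply/eqP => x0'.
move: xE; rewrite -x0'; case: S S0 Sp {le1} => // a S _ /= /andP[a1 Sp].
have := cf_eval_ge0 S (lexx (0 : R)); rewrite cf_eval_cons.
have {}a1 : (1 : R) <= a%:R by rewrite ler1n.
by move=> ? /eqP; rewrite invr_eq0 gt_eqF //; lra.
Qed.

End ContinuedFractions.

(** * Lower and upper bounds along the orbit *)

Section OrbitBounds.

Lemma periodic_cf_fixpoint (R : realType) p (w := false :: rcons p true) :
  0 < periodic_cf R (RL w) /\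
  branches w (periodic_cf R (RL w)) = periodic_cf R (RL w).
Proof.
have w0 : w != [::] by [].
have R0 : RL w != [::] by rewrite RL_eq0.
have [x x0 xE] := cf_eval_fixpoint R R0 (RL_gt0 w).
rewrite (periodic_cf_eq R0 (RL_gt0 w) x0 xE); split=> //.
rewrite -[RHS]xE cf_eval_RL ?(ltW x0) //.
by rewrite /w /= last_rcons.
Qed.

Lemma diverge_negb u v : diverge u v -> diverge (map negb v) (map negb u).
Proof.
move=> [c [s [t [-> ->]]]].
by exists (map negb c), (map negb t), (map negb s); rewrite !map_cat.
Qed.

Lemma map_negbK : involutive (map negb).
Proof. by move=> w; rewrite -map_comp map_id_in // => -[]. Qed.

Variable R : realFieldType.

(** For w = 0p1 and [alpha] in the qumterval of [w], the expansion of [alpha]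
    begins with 0p; call [z] what remains after this prefix.  Since
    inversion exchanges the two branches, b = 1 / c is fixed by 1p0, whence
    1 - c = 0p0(b), while a = 0p1(a); so [z] lies between 0(b) and 1(a).
    The upper bound for [z] comes from [a] being a repelling fixed point of
    the expanding inverse of [w].  The lower bounds compare [alpha] = 0p(z)
    with s(z) for a suffix s of p.  The Lyndon property of [w] compares
    the words 0p1 and s1.  This suffices unless s0 is a prefix of 0p and z < 1;
    then, after cancelling s, 0y(z) has to be compared with z > 0(b), where
    y is a suffix of p, and the Lyndon property of w' shows that
    y0 precedes 1p0, so that y(z) < b. *)
Lemma orbit_bounds p (a c alpha : R) :
    let w := false :: rcons p true in
    let w' := false :: rcons (map negb p) true in
    lyndon w -> lyndon w' ->
    0 < a -> branches w a = a -> 0 < c -> branches w' c = c ->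
    1 - c < alpha < a ->
  exists z, [/\ 0 < z, alpha = branches (false :: p) z, z < 1 + alpha
    & forall q s, p = q ++ s -> alpha < branches s z].
Proof.
move=> w w' lw lw' a0 aE c0 cE /andP[ca aa].
pose b := c^-1.
have b0 : 0 < b by rewrite invr_gt0.
have bE : branches (true :: rcons p false) b = b.
  have := branches_negb w' c0; rewrite cE => h; rewrite -[RHS]h.
  by rewrite /w' /= map_rcons map_negbK.
have leftE : 1 - c = branches (false :: p) (branch false b).
  have E : branches (rcons p false) b = b - 1 by rewrite -{2}bE /=; ring.
  rewrite [RHS]/= -/(branches p _) -(branches_rcons p false) E.
  by rewrite (addrC 1 (b - 1)) subrK mulrBl mulfV ?gt_eqF // mul1r /b invrK.
have rightE : a = branches (false :: p) (branch true a).
  by rewrite -branches_rcons rcons_cons.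
have [z zE /andP[bz za]] : exists2 z, alpha = branches (false :: p) z
    & branch false b < z < branch true a.
  apply: branches_between; rewrite ?branch_ge0 ?ltW //.
  by rewrite -leftE -rightE ca aa.
have zp : 0 < z by apply: le_lt_trans bz; apply: branch_ge0; exact: ltW.
have z0 := ltW zp.
have alpha0 : 0 <= alpha by rewrite zE; exact: branches_ge0.
have wr t : branches (false :: p) (branch true t) = branches w t.
  by rewrite -branches_rcons rcons_cons.
exists z; split=> //.
  (* otherwise [alpha] = w(z - 1) with [z - 1 >= alpha], whereas [w] moves
     every point below its fixed point [a] strictly up *)
  rewrite ltNge; apply/negP => az.
  have : branches w a - branches w alpha < a - alpha by exact: branches0_contract.
  have : branches w alpha <= alpha.
    by rewrite [leRHS]zE -wr; apply: branches_le; rewrite ?branch_ge0 //= addrC.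
  by lra.
move=> q s pE.
have dws : diverge w (rcons s true).
  apply: (lyndon_diverge (q := false :: q) lw) => //; first by case: (s).
  by rewrite /w pE rcons_cat.
have [z1|z1] := leP 1 z.
  (* [z] begins with 1, so [alpha] and [s(z)] begin with [w] and [s1] *)
  have [y zy] : exists y, z = branch true y by exists (z - 1); rewrite /= subrK.
  have y0 : 0 <= y by rewrite zy /= in z1; lra.
  by rewrite zE zy wr -branches_rcons; apply: branches_diverge.
(* [z] begins with 0, and the letter 1 that ends [w] is no longer available *)
have zz : z = branch false (z / (1 - z)).
  by rewrite /=; field; apply/andP; split; lra.
have zz0 : 0 <= z / (1 - z) by apply: divr_ge0; lra.
case: dws => x [y [t [wE sE]]].
(* [x] is the common prefix of [w] and [s1]; if [t] is empty, [s] itself is a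
   prefix of [w] *)
case/lastP: t sE => [|t l] sE.
  have {sE} sE : s = x by move/eqP: sE; rewrite cats1 eqseq_rcons => /andP[/eqP].
  case/lastP: y wE => [|y l] wE.
    by move: wE; rewrite /w cats1 -rcons_cons => /rcons_inj[].
  have {}wE : false :: p = s ++ false :: y.
    by move: wE; rewrite /w sE -rcons_cons -rcons_cons -rcons_cat => /rcons_inj[].
  rewrite zE wE branches_cat; apply: branches_lt.
    exact: branches_ge0.
  apply: le_lt_trans bz; rewrite [leLHS]/= -/(branches y z).
  have y_lt : branches y z < b.
    have [r pE'] : exists r, p = r ++ y.
      case: (s) wE => [|? s'] [] *; first by exists [::].
      by exists (rcons s' false); rewrite cat_rcons.
    rewrite zz -branches_rcons -bE; apply: branches_diverge => //; first exact: ltW.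
    rewrite -[rcons y false]map_negbK -[true :: _]map_negbK; apply: diverge_negb.
    rewrite /= !map_rcons.
    apply: (lyndon_diverge (q := false :: map negb r) lw') => //.
      by case: (map _ y).
    by rewrite /w' pE' map_cat rcons_cat.
  have /andP[] := branch_sub false (branches_ge0 y z0) y_lt.
  by rewrite subr_gt0 => /ltW.
have {}sE : s = x ++ true :: t.
  by move: sE; rewrite -rcons_cons -rcons_cat => /rcons_inj[].
case/lastP: y wE => [|y m] wE.
  by move: wE; rewrite /w cats1 -rcons_cons => /rcons_inj[].
have {}wE : false :: p = x ++ false :: y.
  by move: wE; rewrite /w -rcons_cons -rcons_cons -rcons_cat => /rcons_inj[].
rewrite zE; apply: branches_diverge => //.
by exists x, y, t.
Qed.

End OrbitBounds.

(** * Digits along the orbit *)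

Section Orbit.
Variable R : realType.
Implicit Types (alpha x y z : R).

(** Digits of K_alpha are read off the blocks 01^k of a word: one application of
    K_alpha undoes the letter 0 and the [k] letters 1. *)
Definition blocks (ks : seq nat) : word :=
  flatten [seq false :: nseq k true | k <- ks].

Lemma blocks_cons k ks : blocks (k :: ks) = false :: nseq k true ++ blocks ks.
Proof. by []. Qed.

Lemma blocksP w : exists k ks, w = nseq k true ++ blocks ks.
Proof.
elim: w => [|[] w [k [ks ->]]]; first by exists 0%N, [::].
  by exists k.+1, ks.
by exists 0%N, (k :: ks).
Qed.

Lemma num0_blocks ks : num0 (blocks ks) = size ks.
Proof.
rewrite /num0; elim: ks => // k ks; rewrite blocks_cons /= count_cat => ->.
by rewrite count_nseq mul0n.
Qed.

Lemma branches_block k ks z : branches (blocks (k :: ks)) z =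
  branch false (k%:R + branches (blocks ks) z).
Proof.
rewrite blocks_cons [LHS]/= -/(branches _ z) branches_cat; congr (branch false _).
elim: k => [|k IH] /=; first by rewrite add0r.
by rewrite -/(branches _ _) IH -natr1; ring.
Qed.

Lemma digits_definedS alpha x l : x != 0 ->
  digits_defined alpha (K alpha x) l -> digits_defined alpha x l.+1.
Proof. by move=> x0 H [|[|j]] // jl; rewrite /= -iterS iterSr; apply: (H j.+1). Qed.

Lemma MmatS alpha x l :
  Mmat alpha x l.+1 = (digit_mat (digit alpha x) * Mmat alpha (K alpha x) l)%g.
Proof.
rewrite /Mmat big_ltn // big_add1 /=; congr (_ * _)%g.
rewrite !big_add1 /=; apply: eq_bigr => j _.
by rewrite /digit_at /= -iterS iterSr.
Qed.

(** In the coordinate [x + 1], an application of K_alpha to [x < 0] with digit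
    [k + 2] undoes the block 01^k; the hypothesis says that the result lies in
    the domain, so that [k + 2] is indeed the digit. *)
Lemma block_step_neg alpha (k : nat) y (x := branch false (k%:R + y) - 1) :
  0 <= y -> alpha < y < 1 + alpha ->
  [/\ x != 0, digit alpha x = k.+2 & K alpha x = y - 1].
Proof.
move=> y0 /andP[ay ya].
have k0 : (0 : R) <= k%:R by rewrite ler0n.
have xE : x = - (k%:R + y + 1)^-1 by rewrite /x /=; field; lra.
have x0 : x != 0 by rewrite xE oppr_eq0 invr_eq0; lra.
have d : digit alpha x = k.+2.
  apply: floor_def; rewrite xE invrN invrK opprK.
  by rewrite -[k.+2]addn2 PoszD !rmorphD /= -!pmulrn; lra.
split=> //; rewrite /K (negbTE x0) d xE invrN invrK opprK.
by rewrite -pmulrn -addn2 natrD; ring.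
Qed.

(** Mirror image of [block_step_neg] under [x -> - x], [alpha -> 1 - alpha].
    The domains [alpha - 1, alpha) are not exchanged at their endpoints, hence
    the strict inequalities. *)
Lemma block_step_pos alpha (k : nat) y (x := 1 - branch false (k%:R + y)) :
  0 <= y -> 1 - alpha < y < 1 + (1 - alpha) ->
  [/\ x != 0, digit alpha x = - k.+2%:Z & K alpha x = 1 - y].
Proof.
move=> y0 /andP[ay ya].
have k0 : (0 : R) <= k%:R by rewrite ler0n.
have xE : x = (k%:R + y + 1)^-1 by rewrite /x /=; field; lra.
have x0 : x != 0 by rewrite xE invr_eq0; lra.
have d : digit alpha x = - k.+2%:Z.
  apply: floor_def; rewrite xE invrK.
  by rewrite -[k.+2]addn2 PoszD rmorphD rmorphN !rmorphD /= -!pmulrn; lra.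
split=> //; rewrite /K (negbTE x0) d xE invrK.
by rewrite rmorphN /= -pmulrn -addn2 natrD; ring.
Qed.

(** Common to both orbits: [st] maps the values attached to the suffixes of the
    word to the points of the orbit, namely [y - 1] for the orbit of
    [alpha - 1] with [r = alpha], and [1 - y] for the orbit of [alpha] with
    [r = 1 - alpha]. *)
Lemma Mmat_blocks alpha r z (st : R -> R) (d : nat -> int) ks :
  (forall k y, 0 <= y -> r < y < 1 + r -> let x := st (branch false (k%:R + y)) in
    [/\ x != 0, digit alpha x = d k & K alpha x = st y]) ->
  0 < r -> 0 <= z -> z < 1 + r ->
  (forall q s, q != [::] -> blocks ks = q ++ s -> r < branches s z) ->
  let x := st (branches (blocks ks) z) in
  digits_defined alpha x (size ks) /\
  Mmat alpha x (size ks) = foldr (fun k M => digit_mat (d k) * M)%g 1%g ks.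
Proof.
move=> step r0 z0 zr; elim: ks => [|k ks IH] rP x.
  split=> [j|]; first by rewrite leqn0; case: j.
  by rewrite /Mmat big_geq.
have rks : r < branches (blocks ks) z.
  by apply: (rP (false :: nseq k true)); rewrite ?blocks_cons.
have ksr : branches (blocks ks) z < 1 + r.
  case: (ks) => [|k' ks'] //; rewrite branches_block.
  apply: lt_trans (branch0_lt1 _) _; last by rewrite ltrDl.
  by rewrite addr_ge0 // branches_ge0.
have [||x0 dx Kx] := step k (branches (blocks ks) z); rewrite ?rks //.
  exact: branches_ge0.
have [|dd MM] := IH.
  move=> q s q0 E; apply: (rP (false :: nseq k true ++ q)) => //.
  by rewrite blocks_cons E catA.
rewrite -branches_block -/x in x0 dx Kx.
split; first by apply: digits_definedS; rewrite ?Kx.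
by rewrite MmatS dx Kx MM.
Qed.

End Orbit.

(** * The matching relation *)

Section Matching.
Local Open Scope group_scope.

Definition word_prod (A B : PSL2Z) (w : word) : PSL2Z :=
  foldr (fun b M => (if b then B else A) * M) 1 w.

Lemma word_prod_cat A B u v :
  word_prod A B (u ++ v) = word_prod A B u * word_prod A B v.
Proof. by elim: u => [|b u IH] /=; rewrite ?mul1g // IH mulgA. Qed.

Lemma word_prod_negb A B w : word_prod A B (map negb w) = word_prod B A w.
Proof. by elim: w => //= b w ->; case: b. Qed.

Lemma word_prod_conj A B A' B' X w : A * X = X * A' -> B * X = X * B' ->
  word_prod A B w * X = X * word_prod A' B' w.
Proof.
move=> AX BX; elim: w => [|b w IH] /=; first by rewrite mul1g mulg1.
by rewrite -mulgA IH !mulgA; case: b; rewrite ?AX ?BX.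
Qed.

Lemma word_prod_blocks (d : nat -> int) B ks :
  (forall k, digit_mat (d k.+1) = digit_mat (d k) * B) ->
  foldr (fun k M => digit_mat (d k) * M) 1 ks
    = word_prod (digit_mat (d 0%N)) B (blocks ks).
Proof.
move=> dS; elim: ks => // k ks IH; rewrite blocks_cons /= IH word_prod_cat mulgA.
congr (_ * _); elim: k => [|k IHk] /=; first by rewrite mulg1.
rewrite dS IHk -!mulgA; congr (_ * _).
by elim: (k) => [|k' IHk'] /=; rewrite ?mulg1 ?mul1g // -mulgA IHk'.
Qed.

Lemma mx2M a b c d a' b' c' d' : (mx2 a b c d * mx2 a' b' c' d' =
  mx2 (a * a' + b * c') (a * b' + b * d') (c * a' + d * c') (c * b' + d * d'))%R.
Proof.
apply/matrixP => i j; rewrite !mxE !big_ord_recl big_ord0 !mxE /= addr0.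
by case: i j => [[|[|i]] hi] [[|[|j]] hj].
Qed.

Lemma mx2N a b c d : (- mx2 a b c d = mx2 (- a) (- b) (- c) (- d))%R.
Proof.
by apply/matrixP => i j; rewrite !mxE; case: i j => [[|[|i]] hi] [[|[|j]] hj].
Qed.

Lemma digit_matS c : digit_mat (c + 1)%R = digit_mat c * matT.
Proof.
rewrite -toPSLM; apply/toPSL_eq/orP; left; apply/eqP/val_inj.
rewrite /= mx2M; congr mx2; lia.
Qed.

Lemma matS2 : matS * matS = 1.
Proof.
rewrite -toPSLM; apply/toPSL_eq/orP; right; apply/eqP/val_inj.
rewrite /= mx2M; apply/matrixP => i j; rewrite !mxE.
by case: i j => [[|[|i]] hi] [[|[|j]] hj].
Qed.

(** The substitutions 0 -> ST^2, 1 -> T and 0 -> T^-1, 1 -> ST^-2 are conjugate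
    by X = STS.  This is the content of the next two lemmas, the first one
    being multiplied by T on the right to avoid an inverse. *)
Lemma digit2_conj :
  digit_mat 2 * (matS * matT * matS) * matT = matS * matT * matS.
Proof.
pose s := MkSL2Z det_S; pose t := MkSL2Z det_T; pose d := MkSL2Z (det_digit 2).
suff : toPSL (d * (s * t * s) * t) = toPSL (s * t * s) by rewrite !toPSLM.
by apply/toPSL_eq/orP; left; apply/eqP/val_inj; rewrite /= !mx2M.
Qed.

Lemma matT_conj :
  matT * (matS * matT * matS) = matS * matT * matS * digit_mat (-2).
Proof.
pose s := MkSL2Z det_S; pose t := MkSL2Z det_T; pose d := MkSL2Z (det_digit (-2)).
suff : toPSL (t * (s * t * s)) = toPSL (s * t * s * d) by rewrite !toPSLM.
by apply/toPSL_eq/orP; right; apply/eqP/val_inj; rewrite /= !mx2M mx2N.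
Qed.

Lemma matT_digit2 :
  matT * digit_mat 2 * (matS * matT * matS) = digit_mat (-2).
Proof.
pose s := MkSL2Z det_S; pose t := MkSL2Z det_T; pose d := MkSL2Z (det_digit 2).
suff : toPSL (t * d * (s * t * s)) = toPSL (MkSL2Z (det_digit (-2))).
  by rewrite !toPSLM.
by apply/toPSL_eq/orP; left; apply/eqP/val_inj; rewrite /= !mx2M.
Qed.

(** Write W(p), W'(p) for the products of the letters of p under the two
    substitutions.  By conjugacy W(p) = X W'(p) X^-1, and T (ST^2) X = ST^-2, so
    T ST^2 W(p) = ST^-2 W'(p) X^-1 with X^-1 = ST^-1S.  Complementing p
    exchanges the letters in W'(p), which gives the form below. *)
Lemma matching p :
  matT * word_prod (digit_mat 2) matT (false :: p) =
  word_prod (digit_mat (-2)) matT^-1 (false :: map negb p)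
    * matS * matT^-1 * matS.
Proof.
set X := matS * matT * matS.
have SV : matS^-1 = matS by apply: (mulgI matS); rewrite mulgV matS2.
have XV : X^-1 = matS * matT^-1 * matS by rewrite /X !invgM SV mulgA.
have D2 : digit_mat 2 * X = X * matT^-1.
  by apply: (mulIg matT); rewrite digit2_conj -[RHS]mulgA mulVg mulg1.
have cw := word_prod_conj p D2 matT_conj.
have TX : matT * digit_mat 2 * X = digit_mat (-2) := matT_digit2.
clearbody X.
transitivity (matT * digit_mat 2 * X *
    word_prod matT^-1 (digit_mat (-2)) p * X^-1).
  by rewrite /= -/(word_prod _ _ p) -!mulgA [X * (_ * _)]mulgA -cw mulgK.
by rewrite TX XV /= -!/(word_prod _ _ _) word_prod_negb !mulgA.
Qed.
End Matching.

Theorem theorem4p1 (R : realType) (w : word) (hw : FWstar w) :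
  exists M M' : PSL2Z,
    (forall alpha : R, alpha \in qumterval R w ->
       [/\ digits_defined alpha (alpha - 1) (num0 w),
           Mmat alpha (alpha - 1) (num0 w) = M,
           digits_defined alpha alpha (num1 w)
         & Mmat alpha alpha (num1 w) = M'])
    /\ (matT * M = M' * matS * matT^-1 * matS)%g.
Proof.
have [u [v [uv wE]]] := FWstar_farey_pair hw.
have [p [pE pp]] := farey_pair_palindrome uv.
have [lw lw'] : lyndon w /\ lyndon (dual w).
  have [[u0 v0 lu lv luv] [u0' v0' lu' lv' luv']] := farey_pair_lyndon uv.
  by rewrite wE dual_cat; split; exact: lyndon_catP.
rewrite -wE {u v uv wE} in pE.
have dualE : dual w = false :: rcons (map negb p) true.
  by rewrite pE /dual /= map_rcons rev_cons rev_rcons -map_rev pp.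
rewrite dualE pE in lw lw'.
have [k [ks pks]] := blocksP p.
have [k' [ks' pks']] := blocksP (map negb p).
have {k ks pks} [ks pks] : exists ks, false :: p = blocks ks.
  by exists (k :: ks); rewrite pks.
have {k' ks' pks'} [ks' pks'] : exists ks, false :: map negb p = blocks ks.
  by exists (k' :: ks'); rewrite pks'.
have n0 : num0 w = size ks.
  by rewrite -num0_blocks -pks pE /num0 -rcons_cons -cats1 count_cat addn0.
have n1 : num1 w = size ks'.
  rewrite -num0_blocks -pks' pE /num0 /num1 -rcons_cons -cats1 count_cat /=.
  by rewrite count_map add0n addnC; congr addn; apply: eq_count => -[].
exists (word_prod (digit_mat 2) matT (false :: p)).
exists (word_prod (digit_mat (-2)) matT^-1%g (false :: map negb p)).
split; last exact: matching.
have [a0 aE] := periodic_cf_fixpoint R p.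
have [c0 cE] := periodic_cf_fixpoint R (map negb p).
move=> alpha alphaJ.
have /andP[ca aa] : 1 - periodic_cf R (RL (false :: rcons (map negb p) true))
    < alpha < periodic_cf R (RL (false :: rcons p true)).
  by rewrite -dualE -pE RL_dual; move: alphaJ; rewrite in_itv.
have [|z [z0 zE z1 zP]] := orbit_bounds lw lw' a0 aE c0 cE (alpha := alpha).
  by rewrite ca.
(* exchange the roles of [w] and its dual: the complement of the complement
   of [p] has to appear where [p] was *)
rewrite -(map_negbK p) in lw; rewrite -{1}(map_negbK p) in aE.
have [|z' [z'0 z'E z'1 z'P]] :=
    orbit_bounds lw' lw c0 cE a0 aE (alpha := 1 - alpha).
  by apply/andP; split; lra.
have alpha0 : 0 < alpha by rewrite zE; exact: branches_gt0.
have alpha1 : 0 < 1 - alpha by rewrite z'E; exact: branches_gt0.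
have [|dd MM] := Mmat_blocks (st := fun y => y - 1)
    (fun k y => @block_step_neg R alpha k y) alpha0 (ltW z0) z1 (ks := ks).
  by case=> // b q s _; rewrite -pks => -[_ /zP].
have [|dd' MM'] := Mmat_blocks (st := fun y => 1 - y)
    (fun k y => @block_step_pos R alpha k y) alpha1 (ltW z'0) z'1 (ks := ks').
  by case=> // b q s _; rewrite -pks' => -[_ /z'P].
rewrite -pks -zE in dd MM; rewrite -pks' -z'E subKr in dd' MM'.
rewrite n0 n1 MM MM' pks pks'; split=> //.
  rewrite (word_prod_blocks (B := matT)) // => k.
  by rewrite -digit_matS; congr digit_mat; lia.
rewrite (word_prod_blocks (B := matT^-1%g)) // => k.
apply: (mulIg matT); rewrite -mulgA mulVg mulg1 -digit_matS.
by congr digit_mat; lia.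
Qed.
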